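(* Let $\mathcal{G}=(\mathcal{G}^0,\mathcal{G}^1,r,s)$ be a finite, simple, directed graph without any source. If either $r$ or $s$ is injective, then the compact quantum group $\mathrm{Aut}^{+}_{\mathrm{Bic}}(\mathcal{G})$ is isomorphic to $\mathrm{Aut}^{+}_{\mathrm{Ban}}(\mathcal{G})$.
   Context: $\mathcal{G}^0$ and $\mathcal{G}^1$ are the finite sets of vertices and edges, $r,s:\mathcal{G}^1\to\mathcal{G}^0$ the range and source maps. Simple means without loops and multiple edges; without source means that $r$ is onto. $D$ is the adjacency matrix: $D_{vw}=1$ if there is an edge from $v$ to $w$, and $0$ otherwise. A compact quantum group is a pair $(\mathrm{C}(G),\Delta_G)$ of a unital $\mathrm{C}^*$-algebra and a coassociative unital $*$-homomorphism $\Delta_G:\mathrm{C}(G)\to\mathrm{C}(G)\otimes\mathrm{C}(G)$ (minimal tensor product) such that $\Delta_G(\mathrm{C}(G))(1\otimes\mathrm{C}(G))$ and $\Delta_G(\mathrm{C}(G))(\mathrm{C}(G)\otimes1)$ have dense linear span in $\mathrm{C}(G)\otimes\mathrm{C}(G)$. Isomorphism means a $*$-isomorphism of the $\mathrm{C}^*$-algebras intertwining the comultiplications. $\mathrm{Aut}^{+}_{\mathrm{Ban}}(\mathcal{G})$ (Banica's quantum automorphism group): $\mathrm{C}(\mathrm{Aut}^{+}_{\mathrm{Ban}}(\mathcal{G}))$ is the universal unital $\mathrm{C}^*$-algebra generated by $q_{vw}$, $v,w\in\mathcal{G}^0$, subject to $q_{vw}=q_{vw}^*=q_{vw}^2$,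 $\sum_{w}q_{vw}=\sum_{w}q_{wv}=1$ for all $v$, and $UD=DU$, where $U=(q_{vw})_{v,w\in\mathcal{G}^0}$; the comultiplication is $\Delta(q_{vw})=\sum_{u\in\mathcal{G}^0}q_{vu}\otimes q_{uw}$. $\mathrm{Aut}^{+}_{\mathrm{Bic}}(\mathcal{G})$ (Bichon's quantum automorphism group): $\mathrm{C}(\mathrm{Aut}^{+}_{\mathrm{Bic}}(\mathcal{G}))$ is the universal unital $\mathrm{C}^*$-algebra generated by $q_{vw}$, $v,w\in\mathcal{G}^0$, subject to $q_{vw}=q_{vw}^*=q_{vw}^2$, $\sum_{w}q_{vw}=\sum_{w}q_{wv}=1$ for all $v$, $UD=DU$, where $U=(q_{vw})_{v,w\in\mathcal{G}^0}$, and the additional relations $q_{s(e)s(f)}q_{r(e)r(f)}=q_{r(e)r(f)}q_{s(e)s(f)}$ for all $e,f\in\mathcal{G}^1$, with the comultiplication $\Delta(q_{vw})=\sum_{u\in\mathcal{G}^0}q_{vu}\otimes q_{uw}$. *)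

(* Defs.v *)
From HB Require Import structures.
From mathcomp Require Import all_boot all_order all_algebra.
From mathcomp Require Import complex.
From mathcomp Require Import all_classical all_reals topology normedtype.

Set Implicit Arguments.
Unset Strict Implicit.
Unset Printing Implicit Defensive.

Import Order.TTheory GRing.Theory Num.Theory.
Import numFieldNormedType.Exports.

Local Open Scope classical_set_scope.
Local Open Scope complex_scope.
Local Open Scope ring_scope.

(** * Finite directed graphs *)

Record digraph := Digraph {
  vertex : finType;
  edge : finType;
  erange : edge -> vertex;
  esource : edge -> vertex }.

Definition simple_digraph (G : digraph) : Prop :=
  (forall e : edge G, esource e <> erange e) /\
  injective (fun e : edge G => (esource e, erange e)).

Definition without_source (G : digraph) : Prop :=
  forall v : vertex G, exists e : edge G, erange e = v.

Definition adj (G : digraph) (v w : vertex G) : bool :=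
  [exists e : edge G, (esource e == v) && (erange e == w)].

(** * Unital C*-algebras and Hilbert spaces

    In a [normedModType K] the norm takes its values in [K]; here [K] is the
    field [R[i]] of complex numbers, whose order is the partial order with
    [x <= y] iff [y - x] is a nonnegative real. *)

(* The product is part of this mixin because HB does not allow a join of
   [algType] and [completeNormedModType] above [numDomainType]. *)
HB.mixin Record isCstarAlgebra (R : realType) (A : Type)
    of CompleteNormedModule R[i] A := {
  cone : A;
  cmul : A -> A -> A;
  star : A -> A;
  cmulA : associative cmul;
  cmul1x : left_id cone cmul;
  cmulx1 : right_id cone cmul;
  cmul_linearl : forall y : A, linear (cmul^~ y);
  cmul_linearr : forall x : A, linear (cmul x);
  starK : involutive star;
  starD : {morph star : x y / x + y};
  starZ : forall (c : R[i]) (x : A), star (c *: x) = Num.conj c *: star x;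
  starM : forall x y : A, star (cmul x y) = cmul (star y) (star x);
  norm_mul_le : forall x y : A, `|cmul x y| <= `|x| * `|y|;
  norm_star_mul : forall x : A, `|cmul (star x) x| = `|x| ^+ 2 }.

#[short(type="cstarAlgType")]
HB.structure Definition CstarAlgebra (R : realType) :=
  {A of CompleteNormedModule R[i] A & isCstarAlgebra R A}.

Declare Scope cstar_scope.
Delimit Scope cstar_scope with cstar.
Infix "**" := cmul (at level 40, left associativity) : cstar_scope.
Local Open Scope cstar_scope.

HB.mixin Record isHilbert (R : realType) (H : Type)
    of CompleteNormedModule R[i] H := {
  inner : {dot H for (@Num.conj R[i])};
  inner_norm : forall x : H, inner x x = `|x| ^+ 2 }.

#[short(type="hilbertType")]
HB.structure Definition Hilbert (R : realType) :=
  {H of CompleteNormedModule R[i] H & isHilbert R H}.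

Section Cstar.
Variable R : realType.

Definition star_hom (A B : cstarAlgType R) (f : A -> B) : Prop :=
  [/\ linear f, f cone = cone, {morph f : x y / x ** y} &
      {morph f : x / star x}].

Definition lspan (V : lmodType R[i]) (X : set V) : set V :=
  [set v | exists (n : nat) (c : 'I_n -> R[i]) (x : 'I_n -> V),
     (forall i, X (x i)) /\ v = \sum_(i < n) c i *: x i].

Definition bilinear_map (U V W : lmodType R[i]) (t : U -> V -> W) : Prop :=
  (forall y, linear (t^~ y)) /\ (forall x, linear (t x)).

Definition bounded_operator (H : hilbertType R) (W : H -> H) : Prop :=
  linear W /\ continuous W.

Definition is_opnorm (H : hilbertType R) (W : H -> H) (c : R[i]) : Prop :=
  supremums [set `|W x| | x in [set x : H | `|x| <= 1]] c.

Definition representation (A : cstarAlgType R) (H : hilbertType R)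
    (pi : A -> H -> H) : Prop :=
  [/\ (forall a, bounded_operator (pi a)),
      (forall x, linear (pi^~ x)),
      (forall x, pi cone x = x),
      (forall a b x, pi (a ** b) x = pi a (pi b x)) &
      (forall a x y, inner (pi a x) y = inner x (pi (star a) y))].

(* [L], with the elementary tensors [t x y], is the Hilbert space tensor
   product of [H] and [K]. *)
Definition hilbert_tensor (H K L : hilbertType R) (t : H -> K -> L) : Prop :=
  [/\ bilinear_map t,
      (forall x x' y y',
         inner (t x y) (t x' y') = inner x x' * inner y y') &
      dense (lspan [set t x y | x in [set: H] & y in [set: K]])].

(* The numbers ||(pi (x) rho) (sum_i a_i (x) b_i)||, where [z] lists the pairs
   (a_i, b_i), pi and rho range over all representations of [A] and [B], and
   [W] is the operator (pi (x) rho) (sum_i a_i (x) b_i) on H (x) K. *)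
Definition tensor_rep_norms (A B : cstarAlgType R) (z : seq (A * B)) :
    set R[i] :=
  [set c | exists (H K L : hilbertType R) (t : H -> K -> L)
             (pi : A -> H -> H) (rho : B -> K -> K) (W : L -> L),
     [/\ hilbert_tensor t, representation pi, representation rho,
         bounded_operator W /\
         (forall x y,
            W (t x y) = \sum_(p <- z) t (pi p.1 x) (rho p.2 y)) &
         is_opnorm W c]].

(* [T], with the elementary tensors [t a b], is the minimal (spatial) tensor
   product: the completion of the algebraic tensor product for the norm
   ||z|| = sup { ||(pi (x) rho) z|| : pi, rho representations }. *)
Definition min_tensor (A B T : cstarAlgType R) (t : A -> B -> T) : Prop :=
  [/\ bilinear_map t,
      t cone cone = cone /\
      (forall a a' b b', t a b ** t a' b' = t (a ** a') (b ** b')),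
      (forall a b, star (t a b) = t (star a) (star b)),
      dense (lspan [set t a b | a in [set: A] & b in [set: B]]) &
      (forall z : seq (A * B),
         supremums (tensor_rep_norms z) `|\sum_(p <- z) t p.1 p.2|)].

(** * Compact quantum groups *)

(* [T3] is the triple tensor product, as both (A (x) A) (x) A (via [tl]) and
   A (x) (A (x) A) (via [tr]); [f] is comul (x) id and [g] is id (x) comul. *)
Definition coassociative (A A2 : cstarAlgType R) (t : A -> A -> A2)
    (comul : A -> A2) : Prop :=
  exists (T3 : cstarAlgType R) (tl : A2 -> A -> T3) (tr : A -> A2 -> T3)
         (f g : A2 -> T3),
    [/\ [/\ min_tensor tl, min_tensor tr &
            forall a b c, tl (t a b) c = tr a (t b c)],
        star_hom f /\ (forall a b, f (t a b) = tl (comul a) b),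
        star_hom g /\ (forall a b, g (t a b) = tr a (comul b)) &
        forall a, f (comul a) = g (comul a)].

Record compact_quantum_group := CompactQuantumGroup {
  cqg_alg : cstarAlgType R;
  cqg_alg2 : cstarAlgType R;
  cqg_tensor : cqg_alg -> cqg_alg -> cqg_alg2;
  cqg_tensorP : min_tensor cqg_tensor;
  comul : cqg_alg -> cqg_alg2;
  comul_hom : star_hom comul;
  comul_coassoc : coassociative cqg_tensor comul;
  comul_dense_r :
    dense (lspan [set comul a ** cqg_tensor cone b
                 | a in [set: cqg_alg] & b in [set: cqg_alg]]);
  comul_dense_l :
    dense (lspan [set comul a ** cqg_tensor b cone
                 | a in [set: cqg_alg] & b in [set: cqg_alg]]) }.

(* [Phi] is phi (x) phi. *)
Definition cqg_isomorphic (Q1 Q2 : compact_quantum_group) : Prop :=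
  exists (phi : cqg_alg Q1 -> cqg_alg Q2) (Phi : cqg_alg2 Q1 -> cqg_alg2 Q2),
    [/\ star_hom phi, bijective phi, star_hom Phi,
        (forall a b, Phi (cqg_tensor a b) = cqg_tensor (phi a) (phi b)) &
        (forall a, Phi (comul a) = comul (phi a))].

(** * Quantum automorphism groups of a graph *)

Section Graph.
Variable G : digraph.
Notation V := (vertex G).

Definition relations := forall B : cstarAlgType R, (V -> V -> B) -> Prop.

Definition universal_cstar (rel : relations) (A : cstarAlgType R)
    (q : V -> V -> A) : Prop :=
  rel A q /\
  forall (B : cstarAlgType R) (p : V -> V -> B), rel B p ->
    exists! f : A -> B, star_hom f /\ forall v w, f (q v w) = p v w.

Definition banica_relations : relations := fun B q =>
  [/\ (forall v w, q v w = star (q v w) /\ q v w = q v w ** q v w),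
      (forall v, \sum_w q v w = cone /\ \sum_w q w v = cone) &
      (forall v w, 
         \sum_u (adj u w)%:R *: q v u = \sum_u (adj v u)%:R *: q u w)].

Definition bichon_relations : relations := fun B q =>
  banica_relations q /\
  forall e f : edge G,
    q (esource e) (esource f) ** q (erange e) (erange f) =
    q (erange e) (erange f) ** q (esource e) (esource f).

Definition quantum_aut (rel : relations) (Q : compact_quantum_group) : Prop :=
  exists q : V -> V -> cqg_alg Q,
    universal_cstar rel q /\
    forall v w, comul (q v w) = \sum_u cqg_tensor (q v u) (q u w).

Definition is_aut_banica : compact_quantum_group -> Prop :=
  quantum_aut banica_relations.

Definition is_aut_bichon : compact_quantum_group -> Prop :=
  quantum_aut bichon_relations.

End Graph.
End Cstar.

(* Main.v *)
From HB Require Import structures.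
Require Import Defs.
From mathcomp Require Import all_boot all_order all_algebra.
From mathcomp Require Import complex.
From mathcomp Require Import all_classical all_reals topology normedtype.
From mathcomp Require Import ring.

(* Since r is onto, injectivity of r or of s makes r a bijection, so the
   relation UD = DU says that q_{s(e)s(f)} is the sum of the q_{u r(f)} over
   all edges s(e) -> u. Projections with sum 1 in a C*-algebra are pairwise
   orthogonal, so both q_{s(e)s(f)} q_{r(e)r(f)} and q_{r(e)r(f)} q_{s(e)s(f)}
   are equal to q_{r(e)r(f)}: Banica's relations imply Bichon's. The two
   universal C*-algebras are then isomorphic, and the isomorphism phi extends
   to phi (x) phi because the norm of the minimal tensor product is defined by
   representations, which phi transports. *)

Set Implicit Arguments.
Unset Strict Implicit.
Unset Printing Implicit Defensive.

Import Order.TTheory GRing.Theory Num.Theory.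
Import numFieldNormedType.Exports.

Local Open Scope classical_set_scope.
Local Open Scope complex_scope.
Local Open Scope ring_scope.
Local Open Scope cstar_scope.

(** * Functions with a proof of linearity *)

Definition linear_pack (K : pzRingType) (U V : lmodType K) (f : U -> V)
    (lf : linear f) : {linear U -> V} :=
  HB.pack f (GRing.isLinear.Build K U V _ f lf).

Lemma linear_sum_of (K : pzRingType) (U V : lmodType K) (f : U -> V)
    (I : Type) (r : seq I) (P : pred I) (F : I -> U) : linear f ->
  f (\sum_(i <- r | P i) F i) = \sum_(i <- r | P i) f (F i).
Proof. by move=> lf; exact: (raddf_sum (linear_pack lf)). Qed.

Lemma linear_scale_of (K : pzRingType) (U V : lmodType K) (f : U -> V) c x :
  linear f -> f (c *: x) = c *: f x.
Proof. by move=> lf; exact: (linearZ_LR (linear_pack lf)). Qed.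

(** * Contractions and orthogonality of projections in a C*-algebra *)

Section CstarLemmas.
Variables (R : realType) (A : cstarAlgType R).
Implicit Types x y p q e h : A.

Lemma cmulDr x y z : z ** (x + y) = z ** x + z ** y.
Proof. exact: (raddfD (linear_pack (cmul_linearr z))). Qed.
Lemma cmulBr x y z : z ** (x - y) = z ** x - z ** y.
Proof. exact: (raddfB (linear_pack (cmul_linearr z))). Qed.
Lemma cmulZr c x z : z ** (c *: x) = c *: (z ** x).
Proof. exact: (linearZ_LR (linear_pack (cmul_linearr z))). Qed.
Lemma cmulDl x y z : (x + y) ** z = x ** z + y ** z.
Proof. exact: (raddfD (linear_pack (cmul_linearl z))). Qed.
Lemma cmulBl x y z : (x - y) ** z = x ** z - y ** z.
Proof. exact: (raddfB (linear_pack (cmul_linearl z))). Qed.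
Lemma cmulZl c x z : (c *: x) ** z = c *: (x ** z).
Proof. exact: (linearZ_LR (linear_pack (cmul_linearl z))). Qed.

Lemma cmul_suml (I : Type) (r : seq I) (P : pred I) (F : I -> A) y :
  (\sum_(i <- r | P i) F i) ** y = \sum_(i <- r | P i) F i ** y.
Proof. exact: (linear_sum_of _ _ _ (cmul_linearl y)). Qed.
Lemma cmul_sumr (I : Type) (r : seq I) (P : pred I) (F : I -> A) x :
  x ** (\sum_(i <- r | P i) F i) = \sum_(i <- r | P i) x ** F i.
Proof. exact: (linear_sum_of _ _ _ (cmul_linearr x)). Qed.

Lemma norm_projection p : p = star p -> p = p ** p -> `|p| <= 1.
Proof.
move=> sp pp; have := norm_star_mul p; rewrite -sp -pp => /eqP.
have [->|p0] := eqVneq `|p| 0; first by rewrite ler01.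
by rewrite expr2 -[X in X == _]mulr1 => /eqP /(mulfI p0) <-.
Qed.

(* [s e + N h] is the mean of [s + e_1 + ... + e_N] times the product of the
   contractions [e + e_i h] over all signs e_1, ..., e_N, so the bound is the
   second moment of the random walk started at [s]; the recursion is
   [2 (s e + (N+1) h) = (e + h) ((s+1) e + N h) + (e - h) ((s-1) e + N h)]. *)
Lemma normD_walk e h (n : nat) (s : R[i]) : s \is Num.real ->
  e ** e = e -> e ** h = h -> h ** e = h ->
  `|e| <= 1 -> `|e + h| <= 1 -> `|e - h| <= 1 ->
  `|s *: e + (n%:R : R[i]) *: h| ^+ 2 <= s ^+ 2 + n%:R.
Proof.
move=> sr ee eh he e1 eDh eBh; elim: n s sr => [|n IH] s sr.
  rewrite scale0r !addr0 normrZ exprMn real_normK //.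
  by rewrite -[leRHS]mulr1 ler_wpM2l ?expr_le1// -realEsqr sr.
set a := (s + 1) *: e + (n%:R : R[i]) *: h.
set b := (s - 1) *: e + (n%:R : R[i]) *: h.
have -> : s *: e + (n.+1%:R : R[i]) *: h =
    2^-1 *: ((e + h) ** a + (e - h) ** b).
  have hh : h ** (a - b) = 2 *: h.
    have -> : a - b = 2 *: e.
      rewrite /a /b [X in _ - X]addrC addrKA -scalerBl opprB addrC addrA.
      by rewrite subrK.
    by rewrite cmulZr he.
  have ea : e ** a = a by rewrite /a cmulDr !cmulZr ee eh.
  have eb : e ** b = b by rewrite /b cmulDr !cmulZr ee eh.
  rewrite cmulDl cmulBl ea eb addrACA -cmulBr hh.
  have -> : a + b = 2 *: (s *: e + n%:R *: h).
    rewrite /a /b addrACA -!scalerDl addrACA subrr addr0.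
    by rewrite scalerDr !scalerA !mulr_natl !mulr2n.
  rewrite -scalerDr scalerA mulVf ?pnatr_eq0// scale1r.
  by rewrite -[n.+1]addn1 natrD scalerDl scale1r addrA.
have le2 x y : `|x| <= 1 -> `|x ** y| <= `|y|.
  move=> x1; apply: le_trans (norm_mul_le _ _) _.
  by rewrite -[leRHS]mul1r ler_wpM2r.
have H : `|2^-1 *: ((e + h) ** a + (e - h) ** b)| <= 2^-1 * (`|a| + `|b|).
  rewrite normrZ ger0_norm ?invr_ge0 ?ler0n// ler_wpM2l ?invr_ge0 ?ler0n//.
  by rewrite (le_trans (ler_normD _ _))// lerD// le2.
have -> : s ^+ 2 + n.+1%:R = 2^-1 *
   (((s + 1) ^+ 2 + n%:R) + ((s - 1) ^+ 2 + n%:R)) :> R[i].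
  by rewrite -natr1; field.
apply: le_trans (_ : (2^-1 * (`|a| + `|b|)) ^+ 2 <= _).
  by rewrite ler_sqr ?nnegrE// mulr_ge0 ?invr_ge0 ?addr_ge0 ?ler0n.
apply: le_trans (_ : 2^-1 * (`|a| ^+ 2 + `|b| ^+ 2) <= _); last first.
  rewrite ler_wpM2l ?invr_ge0 ?ler0n//.
  by apply: lerD; apply: IH; [exact: realD|exact: realB].
(* The square of a mean is at most the mean of the squares: the difference is the square of the real
   number [(|a| - |b|) / 2]. *)
rewrite -subr_ge0.
have -> : 2^-1 * (`|a| ^+ 2 + `|b| ^+ 2) - (2^-1 * (`|a| + `|b|)) ^+ 2
  = (2^-1 * (`|a| - `|b|)) ^+ 2.
  by field.
by rewrite -realEsqr realM ?realB ?ger0_real ?invr_ge0 ?ler0n//.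
Qed.

(* The unit [e] is an extreme point of the unit ball. *)
Lemma contraction_pair_eq0 e h : e ** e = e -> e ** h = h ->
  h ** e = h -> `|e| <= 1 -> `|e + h| <= 1 -> `|e - h| <= 1 -> h = 0.
Proof.
move=> ee eh he e1 eDh eBh; apply/normr0_eq0/eqP.
(* The walk bound at [s = 0] reads [n^2 |h|^2 <= n]; dividing by [n] bounds all multiples of
   [|h|^2], so the Archimedean property forces [h = 0]. *)
have H (n : nat) : n%:R * `|h| ^+ 2 <= 1.
  have [->|n0] := eqVneq n 0%N; first by rewrite mul0r ler01.
  have := normD_walk n (real0 _) ee eh he e1 eDh eBh.
  rewrite scale0r add0r expr0n/= add0r normrZ normr_nat exprMn expr2 -mulrA.
  by rewrite -[leRHS]mulr1 ler_pM2l ?ltr0n ?lt0n.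
have hr : `|h| ^+ 2 \is Num.real by rewrite ger0_real// exprn_ge0.
(* The order of [R[i]] is only partial, so the Archimedean argument is run in [R] on the real
   part. *)
have d0 : 0 <= complex.Re (`|h| ^+ 2) by rewrite -lecR RRe_real ?exprn_ge0.
rewrite -sqrf_eq0 -(RRe_real hr).
apply: contraT => dN0.
have d1 : 0 < complex.Re (`|h| ^+ 2).
  by rewrite lt0r d0 andbT; apply: contraNneq dN0 => ->.
have := archi_boundP (ltW (divr_gt0 ltr01 d1)).
set n := Num.bound _; rewrite ltr_pdivrMr// => lt1.
have := H n; rewrite -(RRe_real hr) -(rmorph_nat (real_complex R)) -rmorphM/=.
by rewrite -(rmorph1 (real_complex R)) lecR leNgt lt1.
Qed.

Lemma cstar_eq0 (a : A) : star a ** a = 0 -> a = 0.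
Proof.
move=> a0; apply/normr0_eq0/eqP.
by rewrite -sqrf_eq0 -norm_star_mul a0 normr0.
Qed.

Lemma starB x y : star (x - y) = star x - star y.
Proof. by rewrite starD -scaleN1r starZ rmorphN1 scaleN1r. Qed.

Lemma star_cone : star cone = cone :> A.
Proof. by rewrite -[LHS]cmul1x -[X in X ** _]starK -starM cmul1x starK. Qed.

Lemma norm_compression p q : p = star p -> p = p ** p ->
  q = star q -> q = q ** q -> `|p ** q ** p| <= 1.
Proof.
move=> sp pp sq qq.
have p1 := norm_projection sp pp; have q1 := norm_projection sq qq.
rewrite (le_trans (norm_mul_le _ _))// mulr_ile1//.
by rewrite (le_trans (norm_mul_le _ _))// mulr_ile1.
Qed.

Lemma projections_orthogonal (I : finType) (p : I -> A) (i j : I) :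
  (forall k, p k = star (p k) /\ p k = p k ** p k) ->
  \sum_k p k = cone -> i != j -> p i ** p j = 0.
Proof.
move=> pP p1 ij; have [sj jj] := pP j; have [si ii] := pP i.
(* The compressions [h k], k <> j, have sum 0 and norm of [p j - h k] at most
   1; hence [p j - h i / n] and [p j + h i / n] are contractions. *)
pose h k := p j ** p k ** p j.
have hsum : \sum_k h k = p j.
  have := congr1 (fun x => p j ** x ** p j) p1.
  rewrite cmulx1 -jj => <-.
  by rewrite cmul_sumr cmul_suml.
have hj : h j = p j by rewrite /h -jj -jj.
have jh k : p j ** h k = h k by rewrite /h !cmulA -jj.
have hj' k : h k ** p j = h k by rewrite /h -cmulA -jj.
have nj : `|p j| <= 1 := norm_projection sj jj.
have nB k : `|p j - h k| <= 1.
  have [sk kk] := pP k.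
  have -> : p j - h k = p j ** (cone - p k) ** p j.
    by rewrite cmulBr cmulBl cmulx1 -jj.
  apply: norm_compression => //; first by rewrite starB star_cone -sk.
  by rewrite cmulBr cmulx1 cmulBl -kk cmul1x subrr subr0.
pose n := #|I|.
have nD : `|(n%:R : R[i]) *: p j + h i| <= n%:R.
  (* As [h j = p j] and the [h k] sum to [p j], those with [k] different from [i] and [j] sum to
     [- h i]. This exhibits a sum of [n] contractions, one for each [k]. *)
  have -> : (n%:R : R[i]) *: p j + h i =
      \sum_k (if (k == i) || (k == j) then p j else p j - h k).
    have : \sum_(k | (k != j) && (k != i)) h k = - h i.
      apply/eqP; rewrite -subr_eq0 opprK; apply/eqP.
      move/eqP: hsum; rewrite (bigD1 j)//= hj -subr_eq0 addrAC subrr add0r.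
      by rewrite (bigD1 i)//= addrC => /eqP.
    move=> hE; rewrite -[h i]opprK -hE.
    rewrite scaler_nat -(sumr_const _ (p j)).
    rewrite (bigID (fun k => (k != j) && (k != i)))/= addrAC -sumrB.
    rewrite [RHS](bigID (fun k => (k != j) && (k != i)))/=.
    congr (_ + _); apply: eq_bigr => k.
      by case/andP => /negPf -> /negPf ->.
    by rewrite negb_and !negbK orbC => ->.
  apply: le_trans (ler_norm_sum _ _ _) _.
  rewrite -[leRHS]mul1r mulr_natr -sumr_const; apply: ler_sum => k _.
  by case: ifP.
have n0 : (0 < n)%N by apply/card_gt0P; exists i.
have hi0 : (n%:R : R[i])^-1 *: h i = 0.
  apply: (@contraction_pair_eq0 (p j)) => //.
  - by rewrite cmulZr jh.
  - by rewrite cmulZl hj'.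
  - have -> : p j + (n%:R : R[i])^-1 *: h i =
        (n%:R : R[i])^-1 *: ((n%:R : R[i]) *: p j + h i).
      by rewrite scalerDr scalerA mulVf ?scale1r// pnatr_eq0 -lt0n.
    rewrite normrZ normfV normr_nat ler_pdivrMl ?ltr0n// mulr1//.
  (* Again an average of [n] contractions: [n - 1] copies of [p j] and one [p j - h i]. *)
  - have -> : p j - (n%:R : R[i])^-1 *: h i =
        (n%:R : R[i])^-1 *: ((n.-1%:R : R[i]) *: p j + (p j - h i)).
      rewrite addrA -[X in _ + X - _]scale1r -scalerDl natr1 prednK//.
      by rewrite scalerBr scalerA mulVf ?scale1r// pnatr_eq0 -lt0n.
    rewrite normrZ normfV normr_nat ler_pdivrMl ?ltr0n// mulr1.
    rewrite -[leRHS](congr1 _ (prednK n0)) -natr1 (le_trans (ler_normD _ _))//.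
    by rewrite lerD// normrZ normr_nat ler_piMr.
(* For [x = p i ** p j], the element [star x ** x] is the compression [h i]. *)
apply: cstar_eq0; rewrite starM -si -sj -cmulA (cmulA (p i)) -ii cmulA -/(h i).
rewrite -[LHS]scale1r -(@mulfV _ (n%:R : R[i])) ?pnatr_eq0 -?lt0n//.
by rewrite -scalerA hi0 scaler0.
Qed.

End CstarLemmas.

(** * From Banica's relations to Bichon's *)

Section Graph.
Variables (R : realType) (G : digraph).

(** When [esource] is injective there are at most as many edges as vertices, so a section of the
    surjection [erange] is a bijection and [erange] is its inverse. *)
Lemma erange_inj : without_source G ->
  injective (@erange G) \/ injective (@esource G) -> injective (@erange G).
Proof.
move=> nosrc [//|sinj].
have [g gK] := boolp.choice nosrc.
have [g' g'K gK'] := inj_card_bij (can_inj gK) (leq_card _ sinj).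
by apply: (can_inj (g := g)) => e; rewrite -{1}(gK' e) gK gK'.
Qed.

Lemma banica_bichon (A : cstarAlgType R) (q : vertex G -> vertex G -> A) :
  injective (@erange G) -> banica_relations q -> bichon_relations q.
Proof.
move=> rinj qP; split=> // e f; have [proj q1 qD] := qP.
have -> : q (esource e) (esource f) =
    \sum_u (adj (esource e) u)%:R *: q u (erange f).
  (* On the [UD] side only [u = esource f] survives, because [f] is the only edge ending at
     [erange f]. *)
  rewrite -qD (bigD1 (esource f))//=.
  have -> : adj (esource f) (erange f).
    by apply/existsP; exists f; rewrite !eqxx.
  rewrite scale1r big1 ?addr0// => u uf.
  have [|_] := boolP (adj u (erange f)); last by rewrite scale0r.
  by case/existsP=> f' /andP[/eqP us /eqP/rinj ff]; rewrite -us ff eqxx in uf.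
have orth u : u != erange e -> q u (erange f) ** q (erange e) (erange f) = 0 /\
   q (erange e) (erange f) ** q u (erange f) = 0.
  move=> ue; have colP k := proj k (erange f).
  split; apply: (projections_orthogonal (p := q^~ (erange f))) => //.
  - by case: (q1 (erange f)).
  - by case: (q1 (erange f)).
  - by rewrite eq_sym.
rewrite cmul_suml cmul_sumr.
apply: eq_bigr => u _; rewrite cmulZl cmulZr.
(* For [u = erange e] the two products coincide; for any other [u] both vanish. *)
by have [->//|/orth[-> ->]] := eqVneq u (erange e).
Qed.

End Graph.

(** * Density arguments and extension of isometries *)

Section DenseExtension.
Variable K : numFieldType.
Implicit Types V W : normedModType K.

Lemma lipschitz_bound_continuous V W (f : V -> W) (k : K) : 0 < k ->
  (forall x y, `|f x - f y| <= k * `|x - y|) -> continuous f.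
Proof.
move=> k0 fk x; apply/cvgrPdist_lt => e e0.
have ek0 : 0 < e / k by rewrite divr_gt0.
have xF : \forall t \near nbhs x, `|x - t| < e / k.
  by apply: (@cvgr_dist_lt _ _ _ _ _ id).
apply: filterS xF => y xy; apply: le_lt_trans (fk _ _) _.
by rewrite mulrC -ltr_pdivlMr.
Qed.

Lemma isometry_continuous V W (f : V -> W) :
  (forall x y, `|f x - f y| = `|x - y|) -> continuous f.
Proof.
move=> fi; apply: (lipschitz_bound_continuous (k := 1)) => // x y.
by rewrite fi mul1r.
Qed.

Lemma linear_bound_continuous V W (f : V -> W) (k : K) : linear f ->
  0 < k -> (forall x, `|f x| <= k * `|x|) -> continuous f.
Proof.
move=> lf k0 fk; apply: (lipschitz_bound_continuous k0) => x y.
by rewrite -(raddfB (linear_pack lf)) fk.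
Qed.

Lemma eq_dense V W (D : set V) (f g : V -> W) : dense D ->
  continuous f -> continuous g -> (forall x, D x -> f x = g x) -> f =1 g.
Proof.
move=> dD cf cg fg x; apply/eqP; rewrite -subr_eq0; apply/eqP.
apply: contrapT => fgx.
have [||z [/= zN Dz]] := dD ((f \- g) @^-1` (~` [set 0])).
- by exists x.
- apply: open_comp; first by move=> z _; exact: (continuousB (cf z) (cg z)).
  apply: closed_openC; apply: accessible_closed_set1.
  exact: hausdorff_accessible (@norm_hausdorff _ W).
- by apply: zN; rewrite /= fg// subrr.
Qed.

Lemma le_dist4 V W (x x' z z' : V) (y y' w w' : W) (e : K) :
  `|z - z'| = `|w - w'| -> `|x - z| < e / 4 -> `|x' - z'| < e / 4 ->
  `|y - w| < e / 4 -> `|y' - w'| < e / 4 -> `|x - x'| <= `|y - y'| + e.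
Proof.
move=> zw xz xz' yw yw'.
have tri (U : normedModType K) (a b c d : U) :
    `|a - d| <= `|a - b| + `|b - c| + `|c - d|.
  rewrite -(subrKA c) (le_trans (ler_normD _ _))// lerD2r.
  by rewrite -(subrKA b) ler_normD.
apply: le_trans (tri _ x z z' x') _; rewrite zw.
have wy : `|w - w'| <= e / 4 + `|y - y'| + e / 4.
  apply: le_trans (tri _ w y y' w') _.
  by rewrite !lerD// ltW// distrC.
have -> : `|y - y'| + e = e / 4 + (e / 4 + `|y - y'| + e / 4) + e / 4 by field.
by rewrite !lerD// ltW// distrC.
Qed.

(** The graph of [f] is the closure of the pairs [(u i, u' i)]: completeness of [W] gives a value
    over each point, and preservation of distances makes it unique. *)
Lemma isometric_extension V (W : completeNormedModType K) (I : Type)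
    (u : I -> V) (u' : I -> W) : dense (range u) ->
  (forall i j, `|u i - u j| = `|u' i - u' j|) ->
  exists f : V -> W, (forall i, f (u i) = u' i) /\
    (forall x y, `|f x - f y| = `|x - y|).
Proof.
move=> du uu'.
have approx x (e : K) : 0 < e -> exists i, `|x - u i| < e.
  move=> e0; have [||v [+ [i _ iv]]] := du (ball x e).
  - by exists x; exact: ballxx.
  - exact: ball_open.
  - by rewrite -iv -ball_normE => xi; exists i.
pose graph x y := forall e : K, 0 < e -> exists i,
  `|x - u i| < e /\ `|y - u' i| < e.
have graphP x : exists y, graph x y.
  pose B (e : K) := [set u' i | i in [set i | `|x - u i| < e]].
  pose F := filter_from [set e : K | 0 < e] B.
  have B_ne e : 0 < e -> B e !=set0.
    by move=> /(approx x)[i xi]; exists (u' i), i.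
  have FF : ProperFilter F.
    apply: filter_from_proper => //; apply: filter_from_filter.
      by exists 1; exact: ltr01.
    move=> e e' /= e0 e'0.
    (* The order of [K] may be partial, but positive elements are comparable. *)
    have [ee'|/ltW ee'] := real_leP (gtr0_real e0) (gtr0_real e'0).
      exists e => // _ [i /= xi <-]; split; exists i => //=.
      exact: lt_le_trans xi ee'.
    exists e' => // _ [i /= xi <-]; split; exists i => //=.
    exact: lt_le_trans xi ee'.
  have cF : cauchy F.
    apply: cauchy_exP => e e0; have e20 : 0 < e / 2 by rewrite divr_gt0.
    have [i xi] := approx x _ e20.
    exists (u' i), (e / 2) => // _ [j /= xj <-].
    rewrite -ball_normE/= -uu' -(subrKA x) (le_lt_trans (ler_normD _ _))//.
    by rewrite [ltRHS]splitr ltrD// distrC.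
  have /cauchy_cvgP/cvg_ex[y /fcvgrPdist_lt yF] := cF.
  exists y => e e0.
  have FB : F (B e) by exists e.
  have [w [/= yw [i xi iw]]] := filter_ex (filterI (yF _ e0) FB).
  by exists i; rewrite iw.
have graph_iso x y x' y' : graph x y -> graph x' y' -> `|y - y'| = `|x - x'|.
  move=> xy xy'; apply/le_anti/andP; split; apply/ler_addgt0Pr => e e0;
    have e40 : 0 < e / 4 by rewrite divr_gt0.
  - have [i [xi yi]] := xy _ e40; have [j [xj yj]] := xy' _ e40.
    exact: le_dist4 (esym (uu' i j)) yi yj xi xj.
  - have [i [xi yi]] := xy _ e40; have [j [xj yj]] := xy' _ e40.
    exact: le_dist4 (uu' i j) xi xj yi yj.
have [f fP] := boolp.choice graphP.
exists f; split=> [i|x y]; last exact: graph_iso (fP x) (fP y).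
have ui : graph (u i) (u' i) by move=> e e0; exists i; rewrite !subrr !normr0.
apply/eqP; rewrite -subr_eq0 -normr_eq0 (graph_iso _ _ _ _ (fP (u i)) ui).
by rewrite subrr normr0.
Qed.
End DenseExtension.

(** * Star-homomorphisms, representations and continuity *)

Section StarHom.
Variable R : realType.

Lemma star_hom_id (A : cstarAlgType R) : star_hom (@id A).
Proof. by split. Qed.

Lemma star_hom_comp (A B C : cstarAlgType R) (f : A -> B) (g : B -> C) :
  star_hom f -> star_hom g -> star_hom (g \o f).
Proof.
move=> [fl f1 fM fS] [gl g1 gM gS]; split=> [c x y||x y|x] /=.
- by rewrite fl gl.
- by rewrite f1.
- by rewrite fM.
- by rewrite fS.
Qed.

Lemma norm_star (A : cstarAlgType R) (x : A) : `|star x| = `|x|.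
Proof.
have le (y : A) : `|y| <= `|star y|.
  have [->|y0] := eqVneq y 0; first by rewrite normr0.
  rewrite -(ler_pM2r (x := `|y|)) ?normr_gt0//.
  by rewrite -expr2 -norm_star_mul norm_mul_le.
by apply/le_anti; rewrite le andbT -{2}(starK x) le.
Qed.

Lemma representation_comp (A B : cstarAlgType R) (H : hilbertType R)
    (f : A -> B) (pi : B -> H -> H) :
  star_hom f -> representation pi -> representation (pi \o f).
Proof.
move=> [fl f1 fM fS] [pib pil pi1 piM piS].
split=> [a|x c a b|x|a b x|a x y] /=.
- exact: pib.
- by rewrite fl pil.
- by rewrite f1.
- by rewrite fM.
- by rewrite piS fS.
Qed.

(** Representations of [B1] and [B2] pull back along [f1] and [f2], with the same operator [W]. *)
Lemma tensor_rep_norms_map (A1 A2 B1 B2 : cstarAlgType R) (f1 : A1 -> B1)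
    (f2 : A2 -> B2) (z : seq (A1 * A2)) : star_hom f1 -> star_hom f2 ->
  tensor_rep_norms [seq (f1 p.1, f2 p.2) | p <- z] `<=` tensor_rep_norms z.
Proof.
move=> f1P f2P c [H [L [M [t [pi [rho [W [tP piP rhoP [Wb WE] Wc]]]]]]]].
exists H, L, M, t, (pi \o f1), (rho \o f2), W; split=> //.
- exact: representation_comp.
- exact: representation_comp.
- by split=> // x y; rewrite WE big_map.
Qed.

Lemma cmul_continuousr (A : cstarAlgType R) (x : A) : continuous (cmul x).
Proof.
apply: (linear_bound_continuous (k := `|x| + 1)) (cmul_linearr x) _ _.
  by rewrite ltr_wpDl.
by move=> y; rewrite (le_trans (norm_mul_le _ _))// ler_wpM2r// lerDl.
Qed.

Lemma cmul_continuousl (A : cstarAlgType R) (y : A) : continuous (cmul^~ y).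
Proof.
apply: (linear_bound_continuous (k := `|y| + 1)) (cmul_linearl y) _ _.
  by rewrite ltr_wpDl.
move=> x; rewrite (le_trans (norm_mul_le _ _))// mulrC ler_wpM2r//.
by rewrite lerDl.
Qed.

Lemma star_continuous (A : cstarAlgType R) : continuous (@star R A).
Proof. by apply: isometry_continuous => x y; rewrite -starB norm_star. Qed.

(** * Functoriality of the minimal tensor product *)

Section MinTensorMap.
Variables (A1 A2 B1 B2 T T' : cstarAlgType R).
Variables (t : A1 -> A2 -> T) (t' : B1 -> B2 -> T').
Variables (f1 : A1 -> B1) (g1 : B1 -> A1) (f2 : A2 -> B2) (g2 : B2 -> A2).
Hypotheses (tP : min_tensor t) (t'P : min_tensor t').
Hypotheses (f1P : star_hom f1) (g1P : star_hom g1).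
Hypotheses (f2P : star_hom f2) (g2P : star_hom g2).
Hypotheses (f1K : cancel f1 g1) (f2K : cancel f2 g2).

(** Lists of pairs stand for elements of the algebraic tensor product; that lists with equal [u]
    have equal [u'] will follow from equality of norms. *)
Let u (z : seq (A1 * A2)) := \sum_(p <- z) t p.1 p.2.
Let u' (z : seq (A1 * A2)) := \sum_(p <- z) t' (f1 p.1) (f2 p.2).

(** Both norms are suprema of one set: pulling back along [f1], [f2] gives one inclusion, along
    [g1], [g2] the other. *)
Lemma min_tensor_norm z : `|u z| = `|u' z|.
Proof.
have [_ _ _ _ /(_ z) tz] := tP.
have [_ _ _ _ /(_ [seq (f1 p.1, f2 p.2) | p <- z])] := t'P.
rewrite big_map -/(u' z).
suff -> : tensor_rep_norms [seq (f1 p.1, f2 p.2) | p <- z] = tensor_rep_norms z.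
  exact: is_subset1_supremums.
apply/seteqP; split; first exact: tensor_rep_norms_map.
have := tensor_rep_norms_map (z := [seq (f1 p.1, f2 p.2) | p <- z]) g1P g2P.
rewrite -map_comp map_id_in// => -[a b] _ /=.
by rewrite f1K f2K.
Qed.

Let scale (c : R[i]) (z : seq (A1 * A2)) := [seq (c *: p.1, p.2) | p <- z].

Let uZ c z : u (scale c z) = c *: u z.
Proof.
have [[tl _] _ _ _ _] := tP.
rewrite /u big_map scaler_sumr; apply: eq_bigr => p _ /=.
exact: (linear_scale_of _ _ (tl p.2)).
Qed.

Let u'Z c z : u' (scale c z) = c *: u' z.
Proof.
have [[tl _] _ _ _ _] := t'P; have [fl _ _ _] := f1P.
rewrite /u' big_map scaler_sumr; apply: eq_bigr => p _ /=.
rewrite (linear_scale_of _ _ fl).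
exact: (linear_scale_of _ _ (tl (f2 p.2))).
Qed.

Let uD z z' : u (z ++ z') = u z + u z'. Proof. exact: big_cat. Qed.
Let u'D z z' : u' (z ++ z') = u' z + u' z'. Proof. exact: big_cat. Qed.

Let dense_u : dense (range u).
Proof.
have [_ _ _ dt _] := tP.
move=> O Ox Oo; have [x [Oxx [n [c [y [yt xE]]]]]] := dt O Ox Oo.
exists x; split=> //; rewrite {}xE.
elim/big_ind: _ => [|_ _ [z _ <-] [z' _ <-]|i _].
- by exists [::]; rewrite // /u big_nil.
- by exists (z ++ z').
- have [a _ [b _ <-]] := yt i.
  by exists (scale (c i) [:: (a, b)]); rewrite // uZ /u big_seq1.
Qed.

Lemma min_tensor_map : exists F : T -> T',
  star_hom F /\ forall a b, F (t a b) = t' (f1 a) (f2 b).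
Proof.
have [|F [Fu Fi]] := isometric_extension (u' := u') dense_u.
  (* A difference is the sum over the single list [z ++ scale (-1) z'], so equal norms give equal
     distances. *)
  move=> z z'; rewrite -![_ - _]/(_ + _).
  rewrite -[- u z']scaleN1r -[- u' z']scaleN1r -uZ -u'Z -uD -u'D.
  exact: min_tensor_norm.
have Fc : continuous F := isometry_continuous Fi.
have Ft a b : F (t a b) = t' (f1 a) (f2 b).
  by have := Fu [:: (a, b)]; rewrite /u /u' !big_seq1.
have FZD c z z' : F (c *: u z + u z') = c *: F (u z) + F (u z').
  by rewrite -uZ -uD !Fu u'D u'Z.
have Fl : linear F.
  have cont (W : cstarAlgType R) (c : R[i]) (y : W) :
      continuous (fun x : W => c *: x + y).
    apply: (lipschitz_bound_continuous (k := `|c| + 1)).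
      by rewrite ltr_wpDl.
    move=> x x'; rewrite [c *: x' + y]addrC addrKA -scalerBr normrZ.
    by rewrite ler_wpM2r// lerDl.
  have contr (W : cstarAlgType R) (x : W) : continuous (+%R x).
    by apply: isometry_continuous => y y'; rewrite [x + y]addrC addrKA.
  (* Linearity extends from the range of [u] one variable at a time: first in [x], then in [y]. *)
  have step c x z : F (c *: x + u z) = c *: F x + F (u z).
    apply: (eq_dense dense_u (f := fun x => F (c *: x + u z))
              (g := fun x => c *: F x + F (u z))).
    - move=> {}x; exact: (continuous_comp (cont _ c (u z) x) (Fc _)).
    - move=> {}x; exact: (continuous_comp (Fc x) (cont _ c (F (u z)) _)).
    - by move=> _ [z' _ <-]; exact: FZD.
  move=> c x y; apply: (eq_dense dense_u (f := fun y => F (c *: x + y))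
              (g := fun y => c *: F x + F y)).
  - move=> {}y; exact: (continuous_comp (contr _ (c *: x) y) (Fc _)).
  - move=> {}y; exact: (continuous_comp (Fc y) (contr _ (c *: F x) _)).
  - by move=> _ [z _ <-]; exact: step.
have eqF (f g : T -> T') : linear f -> linear g -> continuous f ->
    continuous g -> (forall a b, f (t a b) = g (t a b)) -> f =1 g.
  move=> lf lg cf cg fg; apply: (eq_dense dense_u) => // _ [z _ <-].
  by rewrite !linear_sum_of//; apply: eq_bigr => p _; exact: fg.
have [_ [t1 tM] tS _ _] := tP; have [_ [t'1 t'M] t'S _ _] := t'P.
have [f1l f11 f1M f1S] := f1P; have [f2l f21 f2M f2S] := f2P.
exists F; split=> //; split=> //.
- by rewrite -t1 Ft f11 f21.
- have lM1 (y : T) : linear (fun x => F (x ** y)).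
    by move=> c x z; rewrite cmul_linearl Fl.
  have lM2 (y : T) : linear (fun x => F x ** F y).
    by move=> c x z; rewrite Fl cmul_linearl.
  have lM3 (x : T) : linear (fun y => F (x ** y)).
    by move=> c y z; rewrite cmul_linearr Fl.
  have lM4 (x : T) : linear (fun y => F x ** F y).
    by move=> c y z; rewrite Fl cmul_linearr.
  (* Both sides are linear and continuous in each factor, so the right factor, then the left, is
     reduced to an elementary tensor. *)
  move=> x; apply: (eqF _ _) => //.
  + by move=> y; apply: continuous_comp; [exact: cmul_continuousr|exact: Fc].
  + by move=> y; apply: continuous_comp; [exact: Fc|exact: cmul_continuousr].
  move=> a b; move: x; apply: (eqF _ _) => //.
  + by move=> y; apply: continuous_comp; [exact: cmul_continuousl|exact: Fc].
  + move=> y; apply: (continuous_comp (g := cmul^~ (F (t a b)))).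
      exact: Fc.
    exact: cmul_continuousl.
  by move=> a' b'; rewrite tM !Ft t'M f1M f2M.
(* Conjugating [F] by the antilinear [star] gives a linear map, to which [eqF] applies. *)
- have starFc : continuous (fun x => star (F (star x))).
    move=> x; apply: (continuous_comp (g := @star R T')).
      by apply: continuous_comp; [exact: star_continuous|exact: Fc].
    exact: star_continuous.
  have starFl : linear (fun x => star (F (star x))).
    by move=> c x y; rewrite starD starZ Fl starD starZ conjCK.
  have starF : (fun x => star (F (star x))) =1 F.
    apply: (eqF _ _) => // a b.
    by rewrite tS Ft t'S f1S f2S !starK.
  by move=> x; have := starF (star x); rewrite starK.
Qed.
End MinTensorMap.
End StarHom.

(** * Uniqueness of homomorphisms out of universal algebras *)

Section UniversalHom.
Variables (R : realType) (G : digraph).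
Notation V := (vertex G).

Lemma universal_hom_eq (rel : relations R G) (A B : cstarAlgType R)
    (q : V -> V -> A) (f g : A -> B) : universal_cstar rel q ->
  rel B (fun v w => f (q v w)) -> star_hom f -> star_hom g ->
  (forall v w, f (q v w) = g (q v w)) -> f = g.
Proof.
move=> [_ univ] /univ [h [_ hu]] fP gP fg.
by rewrite -(hu f)//; apply: hu; split=> // v w; rewrite fg.
Qed.

Lemma bichon_relations_hom (A B : cstarAlgType R) (q : V -> V -> A)
    (f : A -> B) : star_hom f -> bichon_relations q ->
  bichon_relations (fun v w => f (q v w)).
Proof.
move=> [fl f1 fM fS] [[proj q1 qD] qC]; split; last first.
  by move=> e e'; rewrite -!fM qC.
split=> [v w|v|v w].
- by have [s p] := proj v w; rewrite -fS -s -fM -p.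
- by have [r c] := q1 v; rewrite -!linear_sum_of// r c f1.
- have := congr1 f (qD v w); rewrite !linear_sum_of//.
  under eq_bigr do rewrite linear_scale_of//.
  by under [RHS]eq_bigr do rewrite linear_scale_of//.
Qed.
End UniversalHom.

(** * The isomorphism of quantum groups *)

Theorem theorem1p7 (R : realType) (G : digraph)
    (Gsimple : simple_digraph G) (Gnosource : without_source G)
    (Ginj : injective (@erange G) \/ injective (@esource G))
    (Qbic Qban : compact_quantum_group R)
    (HQbic : is_aut_bichon G Qbic) (HQban : is_aut_banica G Qban) :
  cqg_isomorphic Qbic Qban.
Proof.
have rinj := erange_inj Gnosource Ginj.
have [q [qU comul_q]] := HQbic; have [q' [q'U comul_q']] := HQban.
have qP := qU.1; have q'P := banica_bichon rinj q'U.1.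
(* [phi] exists because Banica's generators satisfy Bichon's relations, [psi] because Bichon's
   relations include Banica's. *)
have [phi [[phiP phiq] _]] := qU.2 _ _ q'P.
have [psi [[psiP psiq] _]] := q'U.2 _ _ qP.1.
have phiK : cancel phi psi.
  have idP := star_hom_id (cqg_alg Qbic).
  have E : psi \o phi = id.
    apply: (universal_hom_eq qU) => [|||v w] //=.
    - exact: bichon_relations_hom (star_hom_comp phiP psiP) qP.
    - exact: star_hom_comp.
    - by rewrite phiq psiq.
  by move=> x; exact: (congr1 (@^~ x) E).
have psiK : cancel psi phi.
  have idP := star_hom_id (cqg_alg Qban).
  have E : phi \o psi = id.
    apply: (universal_hom_eq q'U) => [|||v w] //=.
    - exact: (bichon_relations_hom (star_hom_comp psiP phiP) q'P).1.
    - exact: star_hom_comp.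
    - by rewrite psiq phiq.
  by move=> x; exact: (congr1 (@^~ x) E).
have [Phi [PhiP Phit]] := min_tensor_map (@cqg_tensorP _ Qbic)
  (@cqg_tensorP _ Qban) phiP psiP phiP psiP phiK phiK.
exists phi, Phi; split=> //; first by exists psi.
have PcP := star_hom_comp (@comul_hom _ Qbic) PhiP.
(* Two star-homomorphisms out of Bichon's universal algebra are compared on generators, where both
   comultiplications have the same matrix form. *)
have E : Phi \o @comul _ Qbic = @comul _ Qban \o phi.
  apply: (universal_hom_eq qU) => //=.
  - exact: (bichon_relations_hom PcP qP).
  - exact: star_hom_comp phiP (@comul_hom _ Qban).
  move=> v w; rewrite comul_q phiq comul_q' linear_sum_of; last by case: PhiP.
  by apply: eq_bigr => u _; rewrite Phit !phiq.
by move=> a; exact: (congr1 (@^~ a) E).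
Qed.
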